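(* Let $V$ be a $C$-vector space of dimension $n\ge2$, $G\subset\mathrm{SL}(V)$ an irreducible finite group, and $Z\subset\mathbb{P}(V)$ an irreducible $G$-invariant curve such that the function field of $Z/G$ is $C(z)$. Then there is an evaluation of the invariants, i.e. a $C$-algebra homomorphism $h:C[V]^G\to C[z]$, which induces the identification of the function field of $Z/G$ with $C(z)$. This evaluation $h$ is essentially the same as the evaluation of the invariants induced by the standard operator $L_{st}$ for the data $G$ and $Z$.
   Context: $C$ is an algebraically closed field of characteristic zero; $C(z)$ has derivation $\frac{d}{dz}$, extended uniquely to the algebraic closure $\overline{C(z)}$; $\pi=\mathrm{Gal}(\overline{C(z)}/C(z))$. $C[V]$ is the symmetric algebra of $V$ (a polynomial ring $C[X_1,\dots,X_n]$ with $V=CX_1+\cdots+CX_n$), graded by degree, with the induced action of $G$, and $\mathbb{P}(V)=\mathrm{Proj}\,C[V]$. $C[V]^G=C[f_1,\dots,f_r]$ with homogeneous generators $f_i$. For $n=2$, $Z=\mathbb{P}(V)$ (and $z$ is chosen such that $0,1,\infty$ are the branch points of $Z\to Z/G$). Let $\mathcal{H}\subset C[V]$ be the homogeneous prime ideal of $Z$. The homogeneous algebra of $Z/G$ is $A=C[V]^G/(\mathcal{H}\cap C[V]^G)$, and the function field of $Z/G$ is $A_{((0))}$, the field of fractions $\frac{a}{b}$ with $a,b\in A$ homogeneous of the same degree, $b\ne0$. That $h$ induces the identification of the function field of $Z/G$ with $C(z)$ means that $h$ factors through $A$ and, for all homogeneous $a,b\in A$ of the same degree with $b\neq0$, $h(b)\ne0$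 and $\frac{a}{b}\in A_{((0))}$ is identified with $\frac{h(a)}{h(b)}\in C(z)$. Two evaluations $h,\tilde h:C[V]^G\to\overline{C(z)}$ are essentially the same if there is $\lambda\in\overline{C(z)}^*$ with $h(f_i)=\lambda^{\deg f_i}\tilde h(f_i)$ for $i=1,\dots,r$. Standard operator: let $G^p$ be the image of $G$ in $\mathrm{PGL}(V)$; then $C(Z)^{G^p}=C(z)$; fix an embedding $C(Z)\subset\overline{C(z)}$ over $C(z)$. Choose $\ell\in V$, $\ell\ne0$; then $\frac{V}{\ell}=\{\frac{v}{\ell}:v\in V\}\subset C(Z)$ and there is $f\in\overline{C(z)}^*$ such that $W:=f\frac{V}{\ell}$ is $\pi$-invariant. The monic operator of order $n$ with solution space $W$ has coefficients in $C(z)$; $L_{st}$ is the operator of the form $(\frac{d}{dz})^n+0\cdot(\frac{d}{dz})^{n-1}+\cdots$ obtained from it by a shift $\frac{d}{dz}\mapsto\frac{d}{dz}+a$ with $a=\frac{h_0'}{h_0}$ for suitable $h_0\in\overline{C(z)}^*$. It does not depend on the choices of $\ell$ and $f$, and its solution space is $gW$ for some $g\in\overline{C(z)}^*$. The evaluation of the invariants induced by $L_{st}$ is the restriction to $C[V]^G$ of the $C$-algebra homomorphism $C[V]\to\overline{C(z)}$ that extends the canonical linear bijection $V\to gW$, $v\mapsto gf\frac{v}{\ell}$, onto the solution space of $L_{st}$. *)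

(* Defs.v *)
From HB Require Import structures.
From mathcomp Require Import all_boot all_order all_fingroup all_algebra.
From mathcomp Require Import mxrepresentation.
From mathcomp Require Import mpoly.
From mathcomp Require boolp.

Set Implicit Arguments.
Unset Strict Implicit.
Unset Printing Implicit Defensive.

Import GRing.Theory.
Local Open Scope ring_scope.
Local Open Scope quotient_scope.

(* {ideal_quot I} is only a comNzRingType in the library; for I prime we make
   it an integral domain, with classically chosen inverses, so that {fraction _}
   applies. *)
Section PrimeQuotient.
Variables (R : comNzRingType) (I : prime_idealr R).

Definition prime_quot : Type := {ideal_quot I}.
HB.instance Definition _ := GRing.ComNzRing.on prime_quot.

Definition pq_unit : {pred prime_quot} :=
  fun x => boolp.asbool (exists y, y * x = 1).

Definition pq_inv (x : prime_quot) : prime_quot :=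
  if boolp.pselect (exists y, y * x = 1) is left xP
  then projT1 (boolp.cid xP) else x.

Fact pq_mulVx : {in pq_unit, left_inverse 1 pq_inv *%R}.
Proof.
move=> x /boolp.asboolP xP; rewrite /pq_inv.
by case: boolp.pselect => // yP; case: (boolp.cid _).
Qed.

Fact pq_unitPl (x y : prime_quot) : y * x = 1 -> pq_unit x.
Proof. by move=> yx; apply/boolp.asboolP; exists y. Qed.

Fact pq_invr_out : {in [predC pq_unit], pq_inv =1 id}.
Proof.
move=> x; rewrite inE /= => /boolp.asboolP xN; rewrite /pq_inv.
by case: boolp.pselect.
Qed.

HB.instance Definition _ := GRing.ComNzRing_hasMulInverse.Build prime_quot
  pq_mulVx pq_unitPl pq_invr_out.

Fact pq_integral : GRing.integral_domain_axiom prime_quot.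
Proof. exact: Quotient.rquot_IdomainAxiom. Qed.

HB.instance Definition _ :=
  GRing.ComUnitRing_isIntegral.Build prime_quot pq_integral.

Definition pq_class (x : R) : prime_quot := \pi_{ideal_quot I} x.

Fact pq_class_zmod_morphism : zmod_morphism pq_class.
Proof. by move=> x y; rewrite /pq_class rmorphB. Qed.

Fact pq_class_monoid_morphism : monoid_morphism pq_class.
Proof. by split=> [|x y]; rewrite /pq_class ?rmorph1 ?rmorphM. Qed.

HB.instance Definition _ :=
  GRing.isZmodMorphism.Build R prime_quot pq_class pq_class_zmod_morphism.
HB.instance Definition _ :=
  GRing.isMonoidMorphism.Build R prime_quot pq_class pq_class_monoid_morphism.

Fact pq_class_eq0 (x : R) : (pq_class x == 0) = (x \in I).
Proof.
have -> : (0 : prime_quot) = pq_class 0 by rewrite rmorph0.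
by rewrite /pq_class -Quotient.idealrBE subr0.
Qed.

End PrimeQuotient.

(* C(z); the variable z is the fraction of 'X. *)
Notation ratfun C := {fraction {poly C}}.

(* Projective varieties: a homogeneous prime ideal of C[V] = {mpoly C[n]} not
   containing the irrelevant ideal is an irreducible closed subset of
   P(V) = Proj C[V]. *)
Section Projective.
Variables (C : fieldType) (n : nat).
Local Notation S := {mpoly C[n]}.

Definition homogeneous_ideal (I : prime_idealr S) : Prop :=
  forall (p : S) (d : nat), p \in I -> pihomog mdeg d p \in I.

Definition proj_prime (I : prime_idealr S) : Prop :=
  homogeneous_ideal I /\ exists i : 'I_n, 'X_i \notin I.

(* A chain of m + 1 irreducible closed subsets of the variety of H. *)
Definition proj_chain (H : prime_idealr S) (m : nat) : Prop :=
  exists P : nat -> prime_idealr S,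
    (forall i, (i <= m)%N -> proj_prime (P i) /\ {subset H <= P i}) /\
    (forall i, (i < m)%N ->
       {subset P i <= P i.+1} /\ exists2 p, p \in P i.+1 & p \notin P i).

Definition proj_dim (H : prime_idealr S) (m : nat) : Prop :=
  proj_chain H m /\ ~ proj_chain H m.+1.

Definition irreducible_curve (H : prime_idealr S) : Prop :=
  proj_prime H /\ proj_dim H 1.

End Projective.

(* The function field C(Z): the homogeneous fractions of degree 0 in the
   fraction field of C[V]/H. *)
Section FunctionField.
Variables (C : fieldType) (n : nat) (H : prime_idealr {mpoly C[n]}).
Local Notation S := {mpoly C[n]}.

Definition hratio (a b : S) : {fraction (prime_quot H)} :=
  (FracField.tofrac (pq_class H a)) / (FracField.tofrac (pq_class H b)).

Definition in_funfield (x : {fraction (prime_quot H)}) : Prop :=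
  exists d (a b : dhomog n C d), (b : S) \notin H /\ x = hratio a b.

Definition funfield_pred : {pred {fraction (prime_quot H)}} :=
  fun x => boolp.asbool (in_funfield x).

Fact funfieldP x : reflect (in_funfield x) (x \in funfield_pred).
Proof. exact: boolp.asboolP. Qed.

Fact hratio_den_neq0 (b : S) :
  b \notin H -> FracField.tofrac (pq_class H b) != 0.
Proof. by rewrite tofrac_eq0 pq_class_eq0. Qed.

Fact hratioE (a b : S) d (aP : a \is d.-homog) (bP : b \is d.-homog) :
  in_funfield (hratio a b).
Proof.
have [bH|bH] := boolP (b \in H); last by exists d, (DHomog aP), (DHomog bP).
exists 0%N, 0, (DHomog (dhomog1 _ _)); split; first by rewrite /= idealr1.
rewrite /hratio /= [pq_class H b](_ : _ = 0); last first.
  by apply/eqP; rewrite pq_class_eq0.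
by rewrite !rmorph0 invr0 mulr0 mul0r.
Qed.

Fact funfield_divring_closed : divring_closed funfield_pred.
Proof.
split.
- apply/funfieldP; exists 0%N, (DHomog (dhomog1 _ _)), (DHomog (dhomog1 _ _)).
  rewrite /= idealr1; split=> //.
  by rewrite /hratio /= !rmorph1 divr1.
- move=> x y /funfieldP[d [a [b [bH ->]]]] /funfieldP[e [a' [b' [b'H ->]]]].
  have -> : hratio a b - hratio a' b' =
    hratio ((a : S) * b' - (a' : S) * b) ((b : S) * b').
    rewrite /hratio !(rmorphB, rmorphM) /=.
    by rewrite -[X in _ + X]mulNr addf_div ?hratio_den_neq0 // mulNr.
  apply/funfieldP; apply: (@hratioE _ _ (d + e)).
    by apply: rpredB; [|rewrite addnC]; apply: dhomogM; exact: dhomog_is_dhomog.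
  by apply: dhomogM; exact: dhomog_is_dhomog.
- move=> x y /funfieldP[d [a [b [bH ->]]]] /funfieldP[e [a' [b' [b'H ->]]]].
  have -> : hratio a b / hratio a' b' =
    hratio ((a : S) * b') ((b : S) * a').
    by rewrite /hratio !rmorphM invf_div mulf_div.
  apply/funfieldP; apply: (@hratioE _ _ (d + e));
    by apply: dhomogM; exact: dhomog_is_dhomog.
Qed.

HB.instance Definition _ := GRing.isDivringClosed.Build
  {fraction (prime_quot H)} funfield_pred funfield_divring_closed.

Record funfield : Type := FunField {
  funfield_val :> {fraction (prime_quot H)};
  _ : funfield_val \in funfield_pred }.

HB.instance Definition _ := [isSub for funfield_val].
HB.instance Definition _ := [Choice of funfield by <:].
HB.instance Definition _ := [SubChoice_isSubIntegralDomain of funfield by <:].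

Fact funfield_field_axiom : GRing.field_axiom funfield.
Proof.
move=> x xN0; have vN0 : funfield_val x != 0.
  apply: contraNneq xN0 => v0; apply/eqP/val_inj.
  exact: etrans v0 (esym (rmorph0 \val)).
pose y : funfield := FunField (rpredVr (valP x)).
have yx : y * x = 1.
  apply: val_inj; have -> : \val (1 : funfield) = 1 by exact: rmorph1.
  have -> : \val (y * x) = \val y * \val x by exact: rmorphM.
  exact: mulVf.
by apply/unitrP; exists y; split; last rewrite mulrC.
Qed.

HB.instance Definition _ :=
  GRing.UnitRing_isField.Build funfield funfield_field_axiom.

Fact hfrac_subproof d (a b : dhomog n C d) : hratio a b \in funfield_pred.
Proof. by apply/funfieldP; exact: (hratioE (valP a) (valP b)). Qed.

(* The rational function a/b on Z (0 if b vanishes on Z). *)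
Definition hfrac d (a b : dhomog n C d) : funfield :=
  FunField (hfrac_subproof a b).

End FunctionField.

(* The matrix rG x acts on V = 'rV[C]_n by right multiplication, and 'X_i is
   the i-th basis vector of V; lin_subst is the extension of this action to
   C[V]. *)
Section Invariants.
Variables (C : fieldType) (gT : finGroupType) (G : {group gT}) (n : nat).
Variable rG : mx_representation C G n.
Local Notation S := {mpoly C[n]}.

Definition lin_subst (A : 'M[C]_n) (p : S) : S :=
  p \mPo [tuple \sum_(j < n) A i j *: 'X_j | i < n].

Definition inv_pred : {pred S} :=
  fun p => [forall x in G, lin_subst (rG x) p == p].

Fact inv_predP p :
  reflect (forall x, x \in G -> lin_subst (rG x) p = p) (p \in inv_pred).
Proof. exact: 'forall_in_eqP. Qed.

Fact inv_subalg_closed : subalg_closed inv_pred.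
Proof.
split=> [|c p q /inv_predP pG /inv_predP qG|p q /inv_predP pG /inv_predP qG];
  apply/inv_predP => x Gx; rewrite /lin_subst.
- exact: rmorph1.
- by rewrite linearP /= -!/(lin_subst _ _) pG ?qG.
- by rewrite rmorphM /= -!/(lin_subst _ _) pG ?qG.
Qed.

HB.instance Definition _ :=
  GRing.isSubalgClosed.Build C S inv_pred inv_subalg_closed.

Record invring : Type := InvRing {
  invring_val :> S;
  _ : invring_val \in inv_pred }.

HB.instance Definition _ := [isSub for invring_val].
HB.instance Definition _ := [Choice of invring by <:].
HB.instance Definition _ := [SubChoice_isSubComNzRing of invring by <:].
HB.instance Definition _ := [SubZmodule_isSubLmodule of invring by <:].
HB.instance Definition _ :=
  [SubNzRing_SubLmodule_isSubLalgebra of invring by <:].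
HB.instance Definition _ := [SubLalgebra_isSubAlgebra of invring by <:].

Definition stable_ideal (H : prime_idealr S) : Prop :=
  forall x, x \in G -> forall p, p \in H -> lin_subst (rG x) p \in H.

(* C[V]^G = C[f_1, ..., f_r] with f_i homogeneous of degree d i. *)
Definition homogeneous_generators (r : nat) (d : 'I_r -> nat)
    (f : 'I_r -> invring) : Prop :=
  (forall i, (f i : S) \is (d i).-homog) /\
  (forall p : invring, exists q : {mpoly C[r]},
     (p : S) = q \mPo [tuple (f i : S) | i < r]).

End Invariants.


Local Notation "p %:F" := (FracField.tofrac p).

Section Identification.
Variables (C : fieldType) (gT : finGroupType) (G : {group gT}) (n : nat).
Variables (rG : mx_representation C G n) (H : prime_idealr {mpoly C[n]}).
Local Notation S := {mpoly C[n]}.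
Implicit Type phi : {rmorphism ratfun C -> funfield H}.

(* phi is a C-algebra isomorphism of C(z) onto A_((0)), which lies in C(Z)
   because A = C[V]^G / (H :&: C[V]^G) is a graded subalgebra of C[V]/H. *)
Definition identifies_quotient phi : Prop :=
  (forall c : C, \val (phi (c%:P)%:F) = (pq_class H c%:MP)%:F) /\
  (forall x : funfield H,
     (exists u : ratfun C, x = phi u) <->
     (exists d (a b : dhomog n C d),
        [/\ (a : S) \in inv_pred rG, (b : S) \in inv_pred rG,
            (b : S) \notin H & x = hfrac H a b])).

Definition induces_identification phi
    (h : {lrmorphism invring rG -> {poly C}}) : Prop :=
  (forall p : invring rG, (p : S) \in H -> h p = 0) /\
  (forall (d : nat) (a b : invring rG),
     (a : S) \is d.-homog -> (b : S) \is d.-homog -> (b : S) \notin H ->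
     h b != 0 /\ \val (phi ((h a)%:F / (h b)%:F)) = hratio H a b).

(* Branch points of Z -> Z/G = P^1, a point of P^1 being Some c or None for
   infinity. Only meant for n = 2, where Z = P(V) (so H = 0): writing z = a/b
   in lowest terms, the fibre over c is the zero divisor of a - c b and the
   fibre over infinity that of b, and c is a branch point when some point of
   P(V), i.e. some nonzero linear form l up to scalars, has multiplicity at
   least 2 in the fibre. *)
Definition branch_point phi (c : option C) : Prop :=
  exists d (a b : dhomog n C d),
    [/\ (b : S) \notin H,
        (forall q a' b' : S, a = q * a' :> S -> b = q * b' :> S ->
           q \is a GRing.unit),
        phi ('X)%:F = hfrac H a b &
        exists (l : dhomog n C 1) (q : S),
          l != 0 /\
          (if c is Some c then (a : S) - c *: (b : S) else (b : S)) =
            (l : S) ^+ 2 * q].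

Definition branch_points_01oo phi : Prop :=
  forall c : option C,
    branch_point phi c <-> [\/ c = Some 0, c = Some 1 | c = None].

End Identification.

Section DifferentialOperators.
Variables (K : fieldType) (D : K -> K).

(* The operator sum_i a_i (d/dz)^i, with coefficients on the left, is encoded
   as the polynomial with coefficients a_i. *)
Definition dop_apply (L : {poly K}) (y : K) : K :=
  \sum_(i < size L) L`_i * iter i D y.

Definition solution_space (L : {poly K}) (y : K) : Prop := dop_apply L y = 0.

(* The product (d/dz + a) o L, from (d/dz) b = b (d/dz) + b'. *)
Definition dop_lmul (a : K) (L : {poly K}) : {poly K} :=
  L * 'X + map_poly D L + a *: L.

(* The substitution d/dz |-> d/dz + a. *)
Definition dop_shift (a : K) (L : {poly K}) : {poly K} :=
  \sum_(i < size L) L`_i *: iter i (dop_lmul a) 1.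

Definition dop_of_space (n : nat) (W : K -> Prop) (L : {poly K}) : Prop :=
  [/\ L \is monic, size L = n.+1 & forall y, solution_space L y <-> W y].

Definition standard_form (n : nat) (L Lst : {poly K}) : Prop :=
  exists h0 : K,
    [/\ h0 != 0, Lst = dop_shift (D h0 / h0) L & Lst`_n.-1 = 0].

End DifferentialOperators.

Section AlgebraicClosure.
Variables (C : fieldType) (K : closedFieldType).
Variable iota : {rmorphism ratfun C -> K}.

Definition is_algebraic_closure : Prop := forall x : K, algebraicOver iota x.

Definition extends_ddz (D : K -> K) : Prop :=
  [/\ forall x y, D (x + y) = D x + D y,
      forall x y, D (x * y) = D x * y + x * D y &
      forall p : {poly C}, D (iota p%:F) = iota (p^`())%:F].

Definition galois_invariant (W : K -> Prop) : Prop :=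
  forall s : {rmorphism K -> K}, bijective s ->
    (forall u, s (iota u) = iota u) -> forall y, W y -> W (s y).

Variables (gT : finGroupType) (G : {group gT}) (n : nat).
Variables (rG : mx_representation C G n) (H : prime_idealr {mpoly C[n]}).
Variable j : {rmorphism funfield H -> K}.

(* The space f (V / l), where V is the space of linear forms. *)
Definition scaled_space (f : K) (l : dhomog n C 1) (y : K) : Prop :=
  exists v : dhomog n C 1, y = f * j (hfrac H v l).

Fact mpolyX_homog (i : 'I_n) : ('X_i : {mpoly C[n]}) \is 1.-homog.
Proof. by rewrite dhomogX /= mdeg1. Qed.

Definition lin_var (i : 'I_n) : dhomog n C 1 := DHomog (mpolyX_homog i).

(* The restriction to C[V]^G of the C-algebra homomorphism C[V] -> K extending
   v |-> f * (v / l). *)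
Definition space_eval (f : K) (l : dhomog n C 1) (p : invring rG) : K :=
  mmap (fun c : C => iota (c%:P)%:F) (fun i => f * j (hfrac H (lin_var i) l))
    (p : {mpoly C[n]}).

Definition essentially_same (r : nat) (d : 'I_r -> nat)
    (f : 'I_r -> invring rG) (h1 h2 : invring rG -> K) : Prop :=
  exists2 lambda : K, lambda != 0 &
    forall i, h1 (f i) = lambda ^+ d i * h2 (f i).

End AlgebraicClosure.

(* Main.v *)
Require Import Defs.
From HB Require Import structures.
From mathcomp Require Import all_boot all_order all_fingroup all_algebra.
From mathcomp Require Import mxrepresentation.
From mathcomp Require Import mpoly.
From mathcomp Require Import ring.
From mathcomp Require boolp.

(** Every evaluation in play is a restriction of a homomorphism
    C[V] -> K, X_i |-> mu * j (X_i / l), for a scalar mu and a linear form l not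
    vanishing on Z ([point_eval]).  A form p of degree d goes to
    mu ^ d * j (p / l ^ d).  Three consequences follow.  Forms vanishing on Z go
    to 0.  A quotient a / b of two forms of equal degree goes to its own image
    in K, whatever mu and l are; this is what inducing the identification with
    C(z) means.  Changing mu and l multiplies the value of a form of degree d by
    the d-th power of one scalar ([point_eval_scale]); this is what being
    essentially the same means.  The evaluation induced by the standard operator
    is the one with mu = g * f, so it is essentially the same as any other.  The
    linear form l in that comparison does not vanish on Z because the linear
    forms that do vanish there form a proper subrepresentation of V, which is 0
    by irreducibility.

    What has to be found is a mu for which all invariants take values in C[z].
    Let e be the least positive difference of degrees of two homogeneous
    invariants a, b not vanishing on Z.  Euclidean division shows that e divides
    the degree of each such invariant ([degree_period]).  Choose theta, by
    extracting an e-th root, so that a and b get the same value.  For an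
    invariant p of degree k * e the quotient p * b ^ k / a ^ k is a rational
    function on Z/G, that is, an element of C(z), and its value is that of p:
    thus all homogeneous invariants take values in C(z)
    ([rational_normalisation]).  Multiplying theta by an e-th root of a common
    denominator of the values of the generators then gives values in C[z]
    ([integral_normalisation]). *)

Set Implicit Arguments.
Unset Strict Implicit.
Unset Printing Implicit Defensive.

Import GRing.Theory.
Local Open Scope ring_scope.

Local Notation "p %:F" := (FracField.tofrac p).

(** * Fractions, homogeneous polynomials and roots *)

Lemma fraction_numden (R : idomainType) (x : {fraction R}) :
  exists2 q : R, q != 0 & exists p : R, x * q%:F = p%:F.
Proof.
elim/quotW: x => x; exists (frac x).2; first exact: denom_ratioP.
have tofracE (p : R) : p%:F = \pi_(FracField.type R)%qT (Ratio p 1).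
  by rewrite /FracField.tofrac -lock.
exists (frac x).1; rewrite !tofracE.
apply: etrans (esym (FracField.pi_mul x _)) _; apply/eqP.
rewrite FracField.equivf_def /FracField.mulf.
rewrite !numden_Ratio ?oner_eq0 ?mulr1 ?denom_ratioP //.
by rewrite mulrC.
Qed.

Lemma closed_field_root (K : closedFieldType) (e : nat) (x : K) :
  (0 < e)%N -> exists y, y ^+ e = x.
Proof.
case: e => // e _; have [y yE] := solve_monicpoly (nth 0 [:: x]) (ltn0Sn e).
exists y; rewrite yE big_ord_recl /= mulr1 big1 ?addr0 // => i _.
by rewrite nth_nil mul0r.
Qed.

Lemma dhomogXn (n : nat) (R : comNzRingType) (d k : nat) (p : {mpoly R[n]}) :
  p \is d.-homog -> p ^+ k \is (d * k)%N.-homog.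
Proof.
move=> ph; elim: k => [|k IHk]; first by rewrite muln0 expr0 dhomog1.
by rewrite exprS mulnS dhomogM.
Qed.

Lemma dhomog_degree0 (n : nat) (R : comNzRingType) (p : {mpoly R[n]}) :
  p \is 0.-homog -> p = (p@_0)%:MP.
Proof.
move=> ph; apply/mpolyP => m; rewrite mcoeffC.
case: eqP => [->|/eqP m0]; first by rewrite mulr1.
by rewrite mulr0 (dhomog_nemf_coeff ph) //= mdeg_eq0.
Qed.

(** * Evaluations at a point of the cone over Z *)

(** Equalities in C(Z) are proved after inclusion in the fraction field of
    C[V]/H; taking this inclusion as a morphism variable lets the generic
    morphism lemmas rewrite under it. *)
Lemma funfield_val_rmorphism (C : fieldType) (n : nat)
    (H : prime_idealr {mpoly C[n]}) :
  exists v : {rmorphism funfield H -> {fraction (prime_quot H)}},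
    forall x, v x = \val x.
Proof. by exists \val. Qed.

Section Evaluation.
Variables (C : fieldType) (n : nat) (H : prime_idealr {mpoly C[n]}).
Variables (K : closedFieldType) (iota : {rmorphism ratfun C -> K}).
Variables (phi : {rmorphism ratfun C -> funfield H}).
Variable j : {rmorphism funfield H -> K}.
Hypothesis phiC : forall c : C, \val (phi (c%:P)%:F) = (pq_class H c%:MP)%:F.
Hypothesis j_over : forall u, j (phi u) = iota u.
Local Notation S := {mpoly C[n]}.

Definition const_emb (c : C) : K := iota (c%:P)%:F.

Fact const_emb_zmod_morphism : zmod_morphism const_emb.
Proof. by move=> x y; rewrite /const_emb !rmorphB. Qed.

Fact const_emb_monoid_morphism : monoid_morphism const_emb.
Proof. by split=> [|x y]; rewrite /const_emb ?rmorph1 ?rmorphM. Qed.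

HB.instance Definition _ :=
  GRing.isZmodMorphism.Build C K const_emb const_emb_zmod_morphism.
HB.instance Definition _ :=
  GRing.isMonoidMorphism.Build C K const_emb const_emb_monoid_morphism.

(** Evaluation at the point of the affine cone over Z, with coordinates in K,
    that lies above the generic point of Z and at which l, if it does not vanish
    on Z, takes the value mu. *)
Definition point_eval (mu : K) (l : dhomog n C 1) : S -> K :=
  mmap const_emb (fun i => mu * j (hfrac H (lin_var C i) l)).

Fact point_eval_zmod_morphism mu l : zmod_morphism (point_eval mu l).
Proof. by move=> p q; rewrite /point_eval rmorphB. Qed.

Fact point_eval_monoid_morphism mu l : monoid_morphism (point_eval mu l).
Proof. by split=> [|p q]; rewrite /point_eval ?rmorph1 ?rmorphM. Qed.

HB.instance Definition _ mu l := GRing.isZmodMorphism.Build S K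
  (point_eval mu l) (point_eval_zmod_morphism mu l).
HB.instance Definition _ mu l := GRing.isMonoidMorphism.Build S K
  (point_eval mu l) (point_eval_monoid_morphism mu l).

Lemma point_evalZ mu l c p :
  point_eval mu l (c *: p) = const_emb c * point_eval mu l p.
Proof. by rewrite /point_eval -mul_mpolyC rmorphM /= mmapC. Qed.

(** A monomial of degree d collects d factors mu and d denominators l.  The
    element y stands for p / l ^ d, given only by its value so that no proof of
    homogeneity has to be supplied. *)
Lemma point_eval_homog mu (l : dhomog n C 1) d (p : S) (y : funfield H) :
  p \is d.-homog ->
  \val y = hratio H p ((l : S) ^+ d) -> point_eval mu l p = mu ^+ d * j y.
Proof.
move=> /dhomogP ph yE.
have mdE m : m \in msupp p -> (\sum_i m i)%N = d.
  by move/ph <-; rewrite -mdegE.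
have [v vE] := funfield_val_rmorphism H.
have -> : y = \sum_(m <- msupp p) phi ((p@_m)%:P)%:F *
    \prod_(i < n) hfrac H (lin_var C i) l ^+ m i.
  apply: val_inj; rewrite yE -vE rmorph_sum.
  rewrite /hratio {1}(mpolyE p) !rmorph_sum mulr_suml.
  apply: eq_big_seq => m mp.
  rewrite rmorphM vE phiC rmorph_prod mpolyXE_id -mul_mpolyC !rmorphM -mulrA.
  congr (_ * _).
  rewrite -(mdE m mp) -prodrXr !rmorph_prod -prodf_div.
  by apply: eq_bigr => i _; rewrite !rmorphXn vE expr_div_n.
rewrite rmorph_sum mulr_sumr; apply: eq_big_seq => m mp.
rewrite rmorphM j_over mulrCA; congr (_ * _).
rewrite /mmap1 rmorph_prod -(mdE m mp) -prodrXr -big_split /=.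
by apply: eq_bigr => i _; rewrite exprMn rmorphXn.
Qed.

(** Homogeneity of H is used here: the components of p are scaled by different
    powers of mu, so each of them has to lie in H. *)
Lemma point_eval_ideal mu l p : homogeneous_ideal H -> p \in H ->
  point_eval mu l p = 0.
Proof.
move=> Hh pH; rewrite (pihomog_partitionE (leqnn (mmeasure mdeg p))).
rewrite rmorph_sum big1 // => i _.
rewrite [LHS](point_eval_homog _ (y := 0) (pihomogP _ _ _)) ?rmorph0 ?mulr0 //.
rewrite /hratio.
have /eqP -> : pq_class H (pihomog mdeg i p) == 0 by rewrite pq_class_eq0 Hh.
by rewrite rmorph0 mul0r.
Qed.

Lemma point_eval_dhomog mu (l : dhomog n C 1) d (p : S) (ph : p \is d.-homog)
    (lh : (l : S) ^+ d \is d.-homog) :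
  point_eval mu l p = mu ^+ d * j (hfrac H (DHomog ph) (DHomog lh)).
Proof. exact: point_eval_homog. Qed.

Lemma dhomog1Xn (l : dhomog n C 1) d : (l : S) ^+ d \is d.-homog.
Proof. by rewrite -[X in X.-homog]mul1n dhomogXn // dhomog_is_dhomog. Qed.

Lemma notin_ideal_expr (p : S) d : p \notin H -> p ^+ d \notin H.
Proof.
move=> pH; elim: d => [|d IHd]; first by rewrite expr0 idealr1.
by rewrite exprS prime_idealrM negb_or pH.
Qed.

Lemma hfrac_neq0 d (a b : dhomog n C d) :
  (a : S) \notin H -> (b : S) \notin H -> hfrac H a b != 0.
Proof.
move=> aH bH; have [v vE] := funfield_val_rmorphism H.
by rewrite -(fmorph_eq0 v) vE mulf_neq0 ?invr_eq0 ?hratio_den_neq0.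
Qed.

Lemma point_eval_neq0 mu (l : dhomog n C 1) d (p : S) :
  mu != 0 -> (l : S) \notin H -> p \is d.-homog -> p \notin H ->
  point_eval mu l p != 0.
Proof.
move=> mu0 lH ph pH; rewrite (point_eval_dhomog mu ph (dhomog1Xn l d)).
by rewrite mulf_neq0 ?expf_neq0 // fmorph_eq0 hfrac_neq0 //= notin_ideal_expr.
Qed.

(** The factors mu ^ d and l ^ d cancel in a quotient of two forms of the same
    degree d. *)
Lemma point_eval_ratio mu (l : dhomog n C 1) d (a b : dhomog n C d) :
  mu != 0 -> (l : S) \notin H -> (b : S) \notin H ->
  point_eval mu l a = j (hfrac H a b) * point_eval mu l b.
Proof.
move=> mu0 lH bH.
rewrite !(point_eval_dhomog mu (dhomog_is_dhomog _) (dhomog1Xn l d)).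
rewrite mulrCA -rmorphM; congr (_ * j _); apply: val_inj.
have [v vE] := funfield_val_rmorphism H; rewrite -!vE rmorphM !vE /= /hratio.
by rewrite mulrA divfK ?hratio_den_neq0.
Qed.

(** Any two evaluations are essentially the same, because
    p / l ^ d = (l' / l) ^ d * (p / l' ^ d); the scalar mu / nu * j (l' / l)
    does not depend on p or d. *)
Lemma point_eval_scale mu nu (l l' : dhomog n C 1) d (p : S) :
  nu != 0 -> (l' : S) \notin H -> p \is d.-homog ->
  point_eval mu l p =
    (mu / nu * j (hfrac H l' l)) ^+ d * point_eval nu l' p.
Proof.
move=> nu0 l'H ph; rewrite (point_eval_dhomog mu ph (dhomog1Xn l d)).
rewrite (point_eval_dhomog nu ph (dhomog1Xn l' d)).
have -> : hfrac H (DHomog ph) (DHomog (dhomog1Xn l d)) =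
    hfrac H l' l ^+ d * hfrac H (DHomog ph) (DHomog (dhomog1Xn l' d)).
  apply: val_inj; have [v vE] := funfield_val_rmorphism H.
  rewrite -!vE rmorphM rmorphXn !vE /= /hratio !rmorphXn [RHS]mulrC expr_div_n.
  by rewrite mulrA divfK // expf_neq0 ?hratio_den_neq0.
by rewrite rmorphM rmorphXn exprMn mulrACA -exprMn divfK.
Qed.

End Evaluation.

(** * Linear forms do not vanish on Z *)

Section LinearForms.
Variables (C : fieldType) (gT : finGroupType) (G : {group gT}) (n : nat).
Variable rG : mx_representation C G n.
Local Notation S := {mpoly C[n]}.

Definition linform (u : 'rV[C]_n) : S := \sum_(i < n) u 0 i *: 'X_i.

Lemma linform_sum (I : Type) (s : seq I) (P : pred I) (a : I -> C)
    (u : I -> 'rV[C]_n) :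
  linform (\sum_(x <- s | P x) a x *: u x) =
    \sum_(x <- s | P x) a x *: linform (u x).
Proof.
rewrite /linform; under [RHS]eq_bigr do rewrite scaler_sumr.
rewrite exchange_big; apply: eq_bigr => i _ /=.
by rewrite summxE scaler_suml; apply: eq_bigr => x _; rewrite mxE scalerA.
Qed.

Lemma linform_delta i : linform (delta_mx 0 i) = 'X_i.
Proof.
rewrite /linform (bigD1 i) //= big1 ?addr0 => [|k ki]; rewrite mxE eqxx ?eqxx.
  by rewrite scale1r.
by rewrite (negPf ki) scale0r.
Qed.

Lemma lin_subst_linform (A : 'M[C]_n) u :
  lin_subst A (linform u) = linform (u *m A).
Proof.
rewrite /lin_subst /linform rmorph_sum /=.
under eq_bigr => i _ do
  rewrite comp_mpolyZ comp_mpolyXU -tnth_nth tnth_mktuple scaler_sumr.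
rewrite exchange_big; apply: eq_bigr => k _ /=.
by rewrite mxE scaler_suml; apply: eq_bigr => i _; rewrite scalerA.
Qed.

Lemma dhomog1_linform (p : S) :
  p \is 1.-homog -> p = linform (\row_i p@_U_(i)).
Proof.
move=> ph; apply/mpolyP => m; rewrite /linform raddf_sum /=.
under eq_bigr => i _ do rewrite mcoeffZ mcoeffX mxE.
have [/eqP/mdeg1P[i /eqP ->]|m1] := eqVneq (mdeg m) 1%N.
  rewrite (bigD1 i) //= eqxx mulr1 big1 ?addr0 // => k ki.
  by rewrite eq_mnm1 (negPf ki) mulr0.
rewrite (dhomog_nemf_coeff ph) // big1 // => i _.
have [mE|_] := eqVneq U_(i)%MM m; last by rewrite mulr0.
by rewrite -mE mdeg1 eqxx in m1.
Qed.

(** The translates of l span V by irreducibility, so if l vanished on Z, which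
    is G-stable, all coordinates would, leaving no point of P(V). *)
Lemma irreducible_linear_form_notin (H : prime_idealr S) (l : dhomog n C 1) :
  mx_irreducible rG -> proj_prime H -> stable_ideal rG H ->
  l != 0 -> (l : S) \notin H.
Proof.
move=> [_ _ irr] [_ [i XiH]] stab l0; apply: contra XiH => lH.
set u := \row_i (l : S)@_U_(i).
have lE : l = linform u :> S by exact/dhomog1_linform/dhomog_is_dhomog.
have u0 : u != 0.
  apply: contra_neq l0 => u0; apply: val_inj; rewrite /= lE u0 /linform big1 //.
  by move=> k _; rewrite mxE scale0r.
have full : (1%:M <= cyclic_mx rG u)%MS.
  by apply: irr; rewrite ?submx1 ?cyclic_mx_module ?cyclic_mx_eq0.
have /cyclic_mxP[A /envelop_mxP[a ->] iE] :=
  submx_trans (submx1 (delta_mx 0 i : 'rV_n)) full.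
rewrite -linform_delta iE mulmx_sumr.
under eq_bigr => x _ do rewrite -scalemxAr.
rewrite linform_sum rpred_sum // => x Gx.
by rewrite -mul_mpolyC idealMr // -lin_subst_linform -lE stab.
Qed.

End LinearForms.

(** * Lifting evaluations with values in C[z] *)

Lemma lift_lrmorphism (C K : fieldType) (A : lalgType C)
    (e : {rmorphism {poly C} -> K}) (E : {rmorphism A -> K}) :
  injective e -> (forall c p, E (c *: p) = e c%:P * E p) ->
  (forall p, exists g, E p = e g) ->
  exists h : {lrmorphism A -> {poly C}}, forall p, e (h p) = E p.
Proof.
move=> e_inj EZ /boolp.choice[h hE].
have hB : zmod_morphism h.
  by move=> p q; apply: e_inj; rewrite rmorphB -!hE rmorphB.
have hM : monoid_morphism h.
  by split=> [|p q]; apply: e_inj; rewrite -hE ?rmorph1 // !rmorphM -!hE.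
have hZ : scalable h.
  by move=> c p; apply: e_inj; rewrite -mul_polyC rmorphM -!hE EZ.
pose hL : {lrmorphism A -> {poly C}} := HB.pack h
  (GRing.isZmodMorphism.Build _ _ h hB) (GRing.isMonoidMorphism.Build _ _ h hM)
  (GRing.isScalable.Build _ _ _ _ h hZ).
by exists hL => p; rewrite -hE.
Qed.

(** * Normalising the values of the invariants *)

Section Rationality.
Variables (C : fieldType) (gT : finGroupType) (G : {group gT}) (n : nat).
Variables (rG : mx_representation C G n) (H : prime_idealr {mpoly C[n]}).
Variables (K : closedFieldType) (iota : {rmorphism ratfun C -> K}).
Variables (phi : {rmorphism ratfun C -> funfield H}).
Variable j : {rmorphism funfield H -> K}.
Hypothesis phiP : identifies_quotient rG phi.
Hypothesis j_over : forall u, j (phi u) = iota u.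
Local Notation S := {mpoly C[n]}.

Definition inv_form d : {pred S} :=
  [pred p | [&& p \in inv_pred rG, p \is d.-homog & p \notin H]].

Lemma inv_formM d e p q :
  p \in inv_form d -> q \in inv_form e -> p * q \in inv_form (d + e).
Proof.
move=> /and3P[pG ph pH] /and3P[qG qh qH].
by apply/and3P; split; rewrite ?rpredM ?dhomogM // prime_idealrM negb_or pH.
Qed.

Lemma inv_formX d p k : p \in inv_form d -> p ^+ k \in inv_form (d * k).
Proof.
move=> pF; elim: k => [|k IHk]; last by rewrite exprS mulnS inv_formM.
by apply/and3P; rewrite expr0 muln0 rpred1 dhomog1 idealr1.
Qed.

(** The coordinate z is a quotient of two invariant forms of equal degree; in
    degree 0 they would be constants, and z is not. *)
Lemma exists_inv_form_pos : exists d p, (0 < d)%N /\ p \in inv_form d.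
Proof.
have [d [a [b [aG bG bH zE]]]] := (phiP.2 _).1 (ex_intro _ ('X)%:F erefl).
exists d, b; split; last by apply/and3P; rewrite dhomog_is_dhomog.
rewrite lt0n; apply/eqP => d0; subst d.
have aC := dhomog_degree0 (dhomog_is_dhomog a).
have bC := dhomog_degree0 (dhomog_is_dhomog b).
set ca := (a : S)@_0 in aC; set cb := (b : S)@_0 in bC.
have [v vE] := funfield_val_rmorphism H.
have : phi (cb%:P * 'X)%:F = phi (ca%:P)%:F.
  apply: val_inj; rewrite -!vE !rmorphM !vE !phiP.1 zE /= /hratio -aC -bC.
  by rewrite mulrCA divff ?mulr1 // hratio_den_neq0.
move/fmorph_inj/eqP; rewrite tofrac_eq.
move=> /eqP/(congr1 (fun p : {poly C} => p`_1)).
rewrite coefMX coefC /= coefC /= => cb0.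
by move: bH; rewrite bC cb0 mpolyC0 rpred0.
Qed.

(** Taking e as the least positive difference of degrees, rather than as the gcd
    of the degrees, directly provides invariants a and b whose quotient has
    degree e. *)
Lemma degree_period : exists e s a b,
  [/\ (0 < e)%N, a \in inv_form (s + e), b \in inv_form s &
      forall d p, p \in inv_form d -> (e %| d)%N].
Proof.
pose P e := boolp.asbool
  (0 < e /\ exists s a b, a \in inv_form (s + e) /\ b \in inv_form s)%N.
have exP : exists e, P e.
  have [d [p [d0 pF]]] := exists_inv_form_pos.
  exists d; apply/boolp.asboolP; split=> //; exists 0%N, p, 1; split=> //.
  by apply/and3P; rewrite rpred1 dhomog1 idealr1.
case: (ex_minnP exP) => e /boolp.asboolP[e0 [s [a [b [aF bF]]]]] emin.
exists e, s, a, b; split=> // d p pF; rewrite /dvdn; apply: contraT.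
rewrite -lt0n => r0; have := ltn_pmod d e0; rewrite ltnNge => /negP[].
apply: emin; apply/boolp.asboolP; split=> //.
(* A degree d not divisible by e would give the pair p b^k, a^k with k = d / e,
   whose degrees differ by the remainder d mod e, less than e. *)
exists ((s + e) * (d %/ e))%N, (p * b ^+ (d %/ e)), (a ^+ (d %/ e)).
rewrite inv_formX //; split=> //.
suff -> : ((s + e) * (d %/ e) + d %% e = d + s * (d %/ e))%N.
  by rewrite inv_formM ?inv_formX.
by rewrite mulnDl -addnA [(e * _)%N]mulnC -divn_eq addnC.
Qed.

Lemma point_eval_mul nu mu (l : dhomog n C 1) d (p : S) : p \is d.-homog ->
  point_eval iota j (nu * mu) l p = nu ^+ d * point_eval iota j mu l p.
Proof.
move=> ph; rewrite !(point_eval_dhomog phiP.1 j_over _ ph (dhomog1Xn l d)).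
by rewrite exprMn mulrA.
Qed.

(** Once a and b have the same value, p and p * b ^ k / a ^ k have the same
    value too, and the latter has degree 0, hence lies in the function field of
    Z/G. *)
Lemma rational_normalisation (l : dhomog n C 1) : (l : S) \notin H ->
  exists e theta, [/\ (0 < e)%N, theta != 0,
    forall d p, p \in inv_form d -> (e %| d)%N &
    forall k p, p \in inv_form (k * e) ->
      exists u, point_eval iota j theta l p = iota u].
Proof.
move=> lH; have [e [s [a [b [e0 aF bF eP]]]]] := degree_period.
have [/and3P[aG ah aH] /and3P[bG bh bH]] := (aF, bF).
pose ev := point_eval iota j.
have ev0 mu d p : mu != 0 -> p \in inv_form d -> ev mu l p != 0.
  move=> mu0 /and3P[_ ph pH].
  exact: (point_eval_neq0 phiP.1 j_over mu0 lH ph).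
(* a / b has degree e, so with this e-th power it takes the value 1. *)
have [theta thetaE] := closed_field_root (ev 1 l b / ev 1 l a) e0.
have a1 := ev0 1 _ _ (oner_neq0 _) aF; have b1 := ev0 1 _ _ (oner_neq0 _) bF.
have theta0 : theta != 0.
  apply: contraTneq (oner_neq0 K) => t0; move/eqP: thetaE.
  rewrite t0 expr0n eqn0Ngt e0 eq_sym mulf_eq0 invr_eq0.
  by rewrite (negPf a1) (negPf b1).
have abE : ev theta l a = ev theta l b.
  rewrite -[theta]mulr1 /ev (point_eval_mul _ _ _ ah) (point_eval_mul _ _ _ bh).
  by rewrite exprD thetaE -mulrA -!/(ev _ _ _) divfK.
exists e, theta; split=> // k p pF.
have paF : p * b ^+ k \in inv_form (s * k + k * e).
  by rewrite addnC inv_formM ?inv_formX.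
have aaF : a ^+ k \in inv_form (s * k + k * e).
  by rewrite [(k * e)%N]mulnC -mulnDl inv_formX.
have [/and3P[cG ch cH] /and3P[dG dh dH]] := (paF, aaF).
have [u uE] : exists u, hfrac H (DHomog ch) (DHomog dh) = phi u.
  by apply/(phiP.2 _).2; exists (s * k + k * e)%N, (DHomog ch), (DHomog dh).
exists u.
have :=
  point_eval_ratio phiP.1 j_over (DHomog ch) (b := DHomog dh) theta0 lH dH.
rewrite uE j_over /= rmorphM !rmorphXn /= -!/(ev _ _ _) abE.
by apply: mulIf; rewrite expf_neq0 ?(ev0 _ _ _ theta0 bF).
Qed.

(** If p does not vanish on Z, replacing theta by rho * theta, with
    rho ^ e = c * q, multiplies its value by (c * q) ^ k, where k * e is its
    degree.  This clears the denominator q when k > 0, and when k = 0 the form p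
    is a constant.  The cofactor c leaves room for a denominator common to
    several forms. *)
Lemma clear_denominator e theta (l : dhomog n C 1) d (p : S) :
    homogeneous_ideal H -> (0 < e)%N ->
    (forall d p, p \in inv_form d -> (e %| d)%N) ->
    (forall k p, p \in inv_form (k * e) ->
      exists u, point_eval iota j theta l p = iota u) ->
    p \in inv_pred rG -> p \is d.-homog ->
  exists2 q : {poly C}, q != 0 & forall c rho, rho ^+ e = iota (c * q)%:F ->
    exists g : {poly C}, point_eval iota j (rho * theta) l p = iota g%:F.
Proof.
move=> Hh e0 eP ratP pG ph; have [pH|pH] := boolP (p \in H).
  exists 1; first exact: oner_neq0.
  move=> c rho _; exists 0; rewrite !rmorph0.
  exact: (point_eval_ideal phiP.1 j_over).
have pF : p \in inv_form d by apply/and3P.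
have /dvdnP[[|k] dE] := eP _ _ pF.
  exists 1; first exact: oner_neq0.
  move=> c rho _; exists ((p@_0)%:P).
  have pC : p = (p@_0)%:MP.
    by apply: dhomog_degree0; move: ph; rewrite dE mul0n.
  by rewrite {1}pC /point_eval mmapC.
have [u uE] : exists u, point_eval iota j theta l p = iota u.
  by apply: (ratP k.+1); rewrite -dE.
have [q q0 [g gE]] := fraction_numden u.
exists q => // c rho rhoE; exists (c * (c * q) ^+ k * g).
rewrite (point_eval_mul _ _ _ ph) uE dE mulnC exprM rhoE -rmorphXn -rmorphM.
congr (iota _); rewrite exprS !(tofracM, tofracXn) -gE; ring.
Qed.

(** The product of the denominators of the generators serves them all; the
    other invariants are polynomials in the generators. *)
Lemma integral_normalisation (l : dhomog n C 1) (r : nat) (d : 'I_r -> nat)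
    (F : 'I_r -> invring rG) :
  homogeneous_ideal H -> (l : S) \notin H -> homogeneous_generators d F ->
  exists2 mu, mu != 0 & forall p : invring rG,
    exists g : {poly C}, point_eval iota j mu l (p : S) = iota g%:F.
Proof.
move=> Hh lH [Fh Fgen].
have [e [theta [e0 theta0 eP ratP]]] := rational_normalisation lH.
have [q q0 qP] := fin_all_exists2 (fun i =>
  clear_denominator Hh e0 eP ratP (valP (F i)) (Fh i)).
have [rho rhoE] := closed_field_root (iota (\prod_i q i)%:F) e0.
have rho0 : rho != 0.
  apply: contra_eq_neq rhoE => ->; rewrite expr0n eqn0Ngt e0 eq_sym fmorph_eq0.
  by rewrite tofrac_eq0; apply/prodf_neq0 => i _; exact: q0.
exists (rho * theta); first by rewrite mulf_neq0.
have /fin_all_exists[g gE] i : exists g : {poly C},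
    point_eval iota j (rho * theta) l (F i : S) = iota g%:F.
  by apply: (qP i (\prod_(k | k != i) q k)); rewrite rhoE (bigD1 i) //= mulrC.
move=> p; have [s ->] := Fgen p.
exists (mmap polyC g s); rewrite comp_mpolyE /mmap !rmorph_sum /=.
apply: eq_bigr => m _; rewrite point_evalZ tofracM rmorphM; congr (_ * _).
rewrite /mmap1 !rmorph_prod; apply: eq_bigr => i _.
by rewrite rmorphXn /= tnth_mktuple gE !rmorphXn.
Qed.

End Rationality.

Theorem corollary4p7
  (C : closedFieldType) (C_char0 : [pchar C] =i pred0)
  (n : nat) (n_ge2 : (2 <= n)%N)
  (gT : finGroupType) (G : {group gT}) (rG : mx_representation C G n)
  (rG_faithful : mx_faithful rG) (rG_irr : mx_irreducible rG)
  (rG_SL : forall x, x \in G -> \det (rG x) = 1)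
  (H : prime_idealr {mpoly C[n]})
  (Z_curve : irreducible_curve H) (Z_stable : stable_ideal rG H)
  (phi : {rmorphism ratfun C -> funfield H})
  (phiP : identifies_quotient rG phi)
  (z_choice : n = 2%N -> branch_points_01oo phi)
  (r : nat) (d : 'I_r -> nat) (F : 'I_r -> invring rG)
  (F_gen : homogeneous_generators d F)
  (K : closedFieldType) (iota : {rmorphism ratfun C -> K})
  (K_closure : is_algebraic_closure iota)
  (D : K -> K) (D_ext : extends_ddz iota D)
  (j : {rmorphism funfield H -> K}) (j_over : forall u, j (phi u) = iota u) :
  exists h : {lrmorphism invring rG -> {poly C}},
    induces_identification phi h /\
    forall (l : dhomog n C 1) (f : K), l != 0 -> f != 0 ->
      galois_invariant iota (scaled_space j f l) ->
    forall L Lst : {poly K},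
      dop_of_space D n (scaled_space j f l) L -> standard_form D n L Lst ->
    forall g : K, g != 0 ->
      (forall y, solution_space D Lst y <-> scaled_space j (g * f) l y) ->
      essentially_same d F
        (fun p => iota (FracField.tofrac (h p)))
        (space_eval iota j (g * f) l).
Proof.
have [[Hh [i XiH]] _] := Z_curve.
pose l0 := lin_var C i.
have l0H : (l0 : {mpoly C[n]}) \notin H by [].
have [mu mu0 intP] := integral_normalisation phiP j_over Hh l0H F_gen.
have e_inj : injective (iota \o (FracField.tofrac (R := {poly C}))).
  by move=> p q /fmorph_inj/eqP; rewrite tofrac_eq => /eqP.
have [h hE] : exists h : {lrmorphism invring rG -> {poly C}},
    forall p, iota (h p)%:F = point_eval iota j mu l0 (p : {mpoly C[n]}).
  pose E : {rmorphism invring rG -> K} := point_eval iota j mu l0 \o \val.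
  apply: (lift_lrmorphism (E := E) e_inj _ intP) => c p.
  exact: point_evalZ.
exists h; split; first split.
- move=> p pH; apply: e_inj; rewrite rmorph0 /= hE.
  exact: (point_eval_ideal phiP.1 j_over).
- move=> e a b ah bh bH.
  have hb0 : iota (h b)%:F != 0.
    by rewrite hE (point_eval_neq0 phiP.1 j_over mu0 l0H bh).
  split; first by move: hb0; rewrite fmorph_eq0 tofrac_eq0.
  suff -> : phi ((h a)%:F / (h b)%:F) = hfrac H (DHomog ah) (DHomog bh) by [].
  apply: (fmorph_inj j); rewrite j_over fmorph_div; apply: (canLR (mulfK hb0)).
  rewrite !hE.
  exact: (point_eval_ratio phiP.1 j_over (DHomog ah) (b := DHomog bh) mu0 l0H).
move=> l f l_neq0 f0 _ L Lst _ _ g g0 _.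
have lH := irreducible_linear_form_notin rG_irr (proj1 Z_curve) Z_stable l_neq0.
have gf0 : g * f != 0 by rewrite mulf_neq0.
exists (mu / (g * f) * j (hfrac H l l0)).
  by rewrite mulf_neq0 ?mulf_neq0 ?invr_eq0 // fmorph_eq0 hfrac_neq0.
move=> k; rewrite hE.
exact: (point_eval_scale phiP.1 j_over mu l0 gf0 lH (F_gen.1 k)).
Qed.
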